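(* Let $1\le \ell\le m$ be integers and let $k=\binom{m}{\ell}$. Given $\Lambda\subseteq I_\ell[m]$, let $\Lambda^{\ast}:=\{[m]\setminus A : A\in\Lambda\}\subseteq I_{m-\ell}[m]$. Then $\Lambda$ is a subclose family in $I_\ell[m]$ if and only if $\Lambda^{\ast}$ is a subclose family in $I_{m-\ell}[m]$. Moreover, $$K_r(\ell,m)=\binom{r}{2}(2\ell-m)+K_r(m-\ell,m)\quad\text{for } 0\le r\le k.$$
   Context: $[m]:=\{1,\dots,m\}$. For an integer $0\le j\le m$, $I_j[m]$ denotes the set of all subsets of $[m]$ of cardinality $j$. For $\Lambda=\{A_1,\dots,A_r\}\subseteq I_j[m]$ with $|\Lambda|=r$ (the $A_i$ distinct), put $K_\Lambda:=\sum_{1\le i<i'\le r}|A_i\cap A_{i'}|$. For an integer $0\le r\le\binom{m}{j}$, put $K_r(j,m):=\max\{K_\Lambda : \Lambda\subseteq I_j[m],\ |\Lambda|=r\}$. A family $\Lambda\subseteq I_j[m]$ is called subclose (in $I_j[m]$) if $K_\Lambda=K_r(j,m)$, where $r=|\Lambda|$. *)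

(* Defs.v *)
From mathcomp Require Import all_boot all_order all_algebra.

Set Implicit Arguments.
Unset Strict Implicit.
Unset Printing Implicit Defensive.

(* The ground set [m] = {1, ..., m} is represented by 'I_m. *)

(* I_j[m] *)
Definition ksubsets (j m : nat) : {set {set 'I_m}} :=
  [set A : {set 'I_m} | #|A| == j].

(* K_Lambda.  The members of Lambda are listed without repetition by
   [enum_val : 'I_#|Lambda| -> {set 'I_m}]; the summand is symmetric, so the
   value does not depend on the listing. *)
Definition pair_sum (m : nat) (Lambda : {set {set 'I_m}}) : nat :=
  \sum_(i < #|Lambda|) \sum_(i' < #|Lambda| | i < i')
    #|(enum_val i : {set 'I_m}) :&: enum_val i'|.

(* K_r(j,m).  For r <= 'C(m, j) the range of the maximum is nonempty; for
   larger r the range is empty and the value is 0 by convention. *)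
Definition max_pair_sum (r j m : nat) : nat :=
  \max_(Lambda : {set {set 'I_m}} |
        (Lambda \subset ksubsets j m) && (#|Lambda| == r)) pair_sum Lambda.

Definition subclose (j m : nat) (Lambda : {set {set 'I_m}}) : Prop :=
  Lambda \subset ksubsets j m /\
  pair_sum Lambda = max_pair_sum #|Lambda| j m.

(* Lambda^* *)
Definition compl_family (m : nat) (Lambda : {set {set 'I_m}}) :
    {set {set 'I_m}} :=
  [set ~: A | A in Lambda].

(* Main.v *)
(* For l-subsets A and B of [m], inclusion-exclusion gives
   |A ∩ B| + m = 2l + |~A ∩ ~B|.  Summing over the pairs of a family of size r,
   K_Λ - K_Λ* = C(r,2) (2l - m) depends only on r, so the bijection
   Λ -> Λ* preserves maximality. *)
Require Import Defs.
From mathcomp Require Import all_boot all_order all_algebra.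
From mathcomp Require Import zify.

(** The square of index pairs splits into the diagonal and two open triangles, and symmetry of [F]
    makes the two triangles contribute equally. *)
Lemma sum_square_sym (n : nat) (F : 'I_n -> 'I_n -> nat) :
  (forall i j, F i j = F j i) ->
  \sum_(i < n) \sum_(j < n) F i j =
  2 * (\sum_(i < n) \sum_(j < n | i < j) F i j) + \sum_(i < n) F i i.
Proof.
move=> symF.
have lower : \sum_(i < n) \sum_(j < n | j < i) F i j =
             \sum_(i < n) \sum_(j < n | i < j) F i j.
  rewrite (exchange_big_dep xpredT) //=.
  by apply: eq_bigr => i _; apply: eq_bigr => j _; exact: symF.
rewrite mul2n -addnn -{2}lower -!big_split /=; apply: eq_bigr => i _.
(* Row [i] is cut into [i < j], [j = i] and the rest, where [j <= i] and [j != i] amount to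
   [j < i]. *)
rewrite (bigID (fun j : 'I_n => i < j)) /= -addnA; congr (_ + _).
rewrite (bigD1 i) ?ltnn //= addnC; congr (_ + _).
apply: eq_bigl => j; rewrite -leqNgt ltn_neqAle andbC; congr (_ && _).
Qed.

(** This removes the enumeration from [pair_sum]: complementation need not respect the order of
    [enum_val], but a sum over all ordered pairs of members can be reindexed freely. *)
Lemma double_pair_sum (m : nat) (Lambda : {set {set 'I_m}}) :
  \sum_(A in Lambda) \sum_(B in Lambda) #|A :&: B| =
  2 * pair_sum Lambda + \sum_(A in Lambda) #|A|.
Proof.
rewrite big_enum_val /=.
under eq_bigr => i _ do rewrite big_enum_val /=.
rewrite sum_square_sym; last by move=> i j; rewrite setIC.
rewrite [in RHS]big_enum_val /=; congr (_ + _).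
by apply: eq_bigr => i _; rewrite setIid.
Qed.

Lemma card_setI_setC (m : nat) (A B : {set 'I_m}) :
  #|A :&: B| + m = #|A| + #|B| + #|~: A :&: ~: B|.
Proof.
have := cardsUI A B; have := cardsC (A :|: B).
by rewrite setCU card_ord; lia.
Qed.

Lemma card_compl_family (m : nat) (Lambda : {set {set 'I_m}}) :
  #|compl_family Lambda| = #|Lambda|.
Proof. by rewrite card_imset //; exact: (inv_inj (@setCK _)). Qed.

Lemma compl_family_ksubsets (l m : nat) (Lambda : {set {set 'I_m}}) :
  Lambda \subset ksubsets l m -> compl_family Lambda \subset ksubsets (m - l) m.
Proof.
move/subsetP=> sL; apply/subsetP=> _ /imsetP[A /sL + ->].
by rewrite !inE => /eqP cA; rewrite cardsCs setCK card_ord cA.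
Qed.

Lemma sum_compl_family (m : nat) (Lambda : {set {set 'I_m}})
    (F : {set 'I_m} -> nat) :
  \sum_(A in compl_family Lambda) F A = \sum_(A in Lambda) F (~: A).
Proof. by rewrite big_imset //= => A B _ _; exact: (inv_inj (@setCK _)). Qed.

(** The terms in [m] and [2 * l] stand on opposite sides because [2 * l - m] may be negative and
    subtraction on [nat] truncates. *)
Lemma pair_sum_compl_family (l m : nat) (Lambda : {set {set 'I_m}}) :
  l <= m -> Lambda \subset ksubsets l m ->
  pair_sum Lambda + 'C(#|Lambda|, 2) * m =
  'C(#|Lambda|, 2) * (2 * l) + pair_sum (compl_family Lambda).
Proof.
move=> lm sL; set r := #|Lambda|.
have card_l A : A \in Lambda -> #|A| = l.
  by move/(subsetP sL); rewrite inE => /eqP.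
have := double_pair_sum _ Lambda; have := double_pair_sum _ (compl_family Lambda).
rewrite !sum_compl_family.
under eq_bigr => A _ do rewrite sum_compl_family.
rewrite [\sum_(A in Lambda) #|A|](eq_bigr (fun=> l)) //.
rewrite [\sum_(A in Lambda) #|~: A|](eq_bigr (fun=> m - l)); last first.
  by move=> A /card_l cA; rewrite cardsCs setCK card_ord cA.
rewrite !sum_nat_const -/r.
(* Inclusion-exclusion is summed over all [r * r] ordered pairs, diagonal included. The diagonals
   total [r * l] and [r * (m - l)]; removing them leaves [r * r - r], that is [2 * 'C(r, 2)],
   off-diagonal pairs. *)
have : \sum_(A in Lambda) \sum_(B in Lambda) #|A :&: B| + r * (r * m) =
    r * (r * (2 * l)) + \sum_(A in Lambda) \sum_(B in Lambda) #|~: A :&: ~: B|.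
  rewrite /r -!sum_nat_const -!big_split /=; apply: eq_bigr => A AL.
  rewrite -!big_split /=; apply: eq_bigr => B BL.
  by rewrite card_setI_setC (card_l _ AL) (card_l _ BL) mul2n addnn.
have : 2 * 'C(r, 2) + r = r * r.
  by have := bin_ffact r 2; rewrite ffactnS ffactn1 -[2`!]/2; case: (r) => //= n; nia.
by nia.
Qed.

Lemma max_pair_sum_ge (r l m : nat) (Lambda : {set {set 'I_m}}) :
  Lambda \subset ksubsets l m -> #|Lambda| = r ->
  pair_sum Lambda <= max_pair_sum r l m.
Proof.
by move=> sL cL; rewrite /max_pair_sum (bigmax_sup Lambda) // sL cL eqxx.
Qed.

Lemma max_pair_sum_attained (r l m : nat) :
  r <= 'C(m, l) -> exists Lambda : {set {set 'I_m}},
    [/\ Lambda \subset ksubsets l m, #|Lambda| = r &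
        max_pair_sum r l m = pair_sum Lambda].
Proof.
move=> hr; rewrite /max_pair_sum.
have [|Lambda] := @eq_bigmax_cond _ [pred L : {set {set 'I_m}} |
    (L \subset ksubsets l m) && (#|L| == r)] (@pair_sum m).
  (* There are ['C('C(m, l), r)] candidate families, a positive number by the bound on [r], so the
     maximum is not the default 0 of an empty range. *)
  have := cards_draws (ksubsets l m) r.
  by rewrite card_draws card_ord cardsE => ->; rewrite bin_gt0.
by rewrite inE => /andP[sL /eqP cL] e; exists Lambda.
Qed.

(** The complement of an optimal family of [l]-subsets competes for the maximum among
    [(m - l)]-subsets. *)
Lemma max_pair_sum_compl_le (r l m : nat) :
  l <= m -> r <= 'C(m, l) ->
  max_pair_sum r l m + 'C(r, 2) * m <=
  'C(r, 2) * (2 * l) + max_pair_sum r (m - l) m.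
Proof.
move=> lm /max_pair_sum_attained[Lambda [sL cL ->]].
rewrite -cL (pair_sum_compl_family l) // leq_add2l.
by rewrite max_pair_sum_ge ?compl_family_ksubsets ?card_compl_family.
Qed.

Lemma max_pair_sum_compl (r l m : nat) :
  l <= m -> r <= 'C(m, l) ->
  max_pair_sum r l m + 'C(r, 2) * m =
  'C(r, 2) * (2 * l) + max_pair_sum r (m - l) m.
Proof.
move=> lm hr; have le1 := max_pair_sum_compl_le _ _ _ lm hr.
(* The reverse inequality is the same bound at [m - l], since [m - (m - l) = l] and the two
   binomials agree; its shift has the opposite sign. *)
have := max_pair_sum_compl_le r (m - l) m (leq_subr _ _).
rewrite bin_sub // subKn // => /(_ hr) le2.
by nia.
Qed.

Theorem proposition5 (m l : nat) (hl : (1 <= l <= m)%N) :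
  (forall Lambda : {set {set 'I_m}}, Lambda \subset ksubsets l m ->
     compl_family Lambda \subset ksubsets (m - l) m /\
     (subclose l Lambda <-> subclose (m - l) (compl_family Lambda))) /\
  (forall r : nat, (r <= 'C(m, l))%N ->
     ((max_pair_sum r l m)%:Z
      = 'C(r, 2)%:Z * (2%:Z * l%:Z - m%:Z)
        + (max_pair_sum r (m - l) m)%:Z :> int)%R).
Proof.
case/andP: hl => _ lm; split=> [Lambda sL|r hr]; last first.
  by have := max_pair_sum_compl _ _ _ lm hr; nia.
have sL' := compl_family_ksubsets _ _ _ sL; split=> //.
have hr : #|Lambda| <= 'C(m, l).
  by have := subset_leq_card sL; rewrite card_draws card_ord.
have eK := pair_sum_compl_family _ _ _ lm sL.
have eM := max_pair_sum_compl _ _ _ lm hr.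
rewrite /subclose card_compl_family.
(* By [eK] and [eM], passing to complements shifts the pair sum and the maximum by the same amount,
   so equality holds on one side exactly when it holds on the other. *)
by split=> -[_ e]; split=> //; lia.
Qed.
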